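(* There is an associative binary operation $\star$ on $\mathrm{ASP}$, characterized by the property that for all $\alpha,\beta\in \mathrm{ASP}$ and all $a,b\in\mathbb{Z}$, $$s_{\alpha\star\beta}(a,b)=\min_{\ell\in\mathbb{Z}}\Big[s_\alpha(a,\ell)+s_\beta(\ell,b)\Big].$$ Moreover, for all $\alpha\in\mathrm{ASP}$ and $n\in\mathbb{Z}$, $$\alpha\star\sigma_n=\begin{cases}\alpha\sigma_n & \text{if }\alpha(n)<\alpha(n+1),\\ \alpha&\text{otherwise,}\end{cases}$$ so $\star$ extends the standard Demazure product on the symmetric group $S_d$.
   Context: A permutation means a bijection $\mathbb{Z}\to\mathbb{Z}$; products of permutations are compositions. $\mathrm{ASP}$ is the group of almost-sign-preserving permutations: those permutations $\alpha$ for which there are only finitely many $n\in\mathbb{Z}$ such that exactly one of $n,\alpha(n)$ is negative. For $\alpha\in\mathrm{ASP}$, define $s_\alpha:\mathbb{Z}^2\to\mathbb{N}$ ($\mathbb{N}$ = nonnegative integers) by $s_\alpha(a,b)=\#\{n\ge b:\ \alpha(n)<a\}$. $\sigma_n$ denotes the simple transposition exchanging $n$ and $n+1$ and fixing all other integers. $S_d$ is regarded as the subgroup of $\mathrm{ASP}$ of permutations fixing every integer outside $\{1,\dots,d\}$. The standard Demazure product on $S_d$ is the associative operation on $S_d$, with the identity permutation as its identity element, determined by the rule that, for $1\le n<d$, $\alpha\star\sigma_n$ equals $\alpha\sigma_n$ if $\alpha(n)<\alpha(n+1)$ and $\alpha$ otherwise. *)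

(* Defs.v *)
From HB Require Import structures.
From mathcomp Require Import all_boot all_order all_algebra finmap.
From mathcomp Require Import boolp classical_sets functions cardinality.
From mathcomp Require Import zify.

Set Implicit Arguments.
Unset Strict Implicit.
Unset Printing Implicit Defensive.

Import Order.TTheory GRing.Theory Num.Theory.
Local Open Scope classical_set_scope.
Local Open Scope ring_scope.

Definition sign_changes (f : int -> int) : set int :=
  [set n | (n < 0) (+) (f n < 0)].

Record ASP := MkASP {
  asp_fun :> int -> int;
  asp_bij : bijective asp_fun;
  asp_fin : finite_set (sign_changes asp_fun) }.

Lemma asp_ext (al be : ASP) : al =1 be -> al = be.
Proof.
case: al be => [f bf ff] [g bg fg] /= /funext fE; rewrite fE in bf ff *.
by rewrite (Prop_irrelevance bf bg) (Prop_irrelevance ff fg).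
Qed.

Lemma asp_inj (al : ASP) : injective al.
Proof. exact: bij_inj (asp_bij al). Qed.

Lemma finite_set_asp_preim (al : ASP) (A : set int) :
  finite_set A -> finite_set (al @^-1` A).
Proof. by apply: finite_preimage => x y _ _; apply: asp_inj. Qed.

Lemma asp_id_fin : finite_set (sign_changes id).
Proof.
by apply: (sub_finite_set _ (finite_set0 _)) => n; rewrite /sign_changes /= addbb.
Qed.

Definition asp_id : ASP := MkASP (Bijective (frefl _) (frefl _)) asp_id_fin.

Lemma asp_comp_fin (al be : ASP) : finite_set (sign_changes (al \o be)).
Proof.
apply: (@sub_finite_set _ _
  (sign_changes be `|` be @^-1` sign_changes al)) => [n|].
  rewrite /sign_changes /=.
  by case: (n < 0); case: (be n < 0); case: (al (be n) < 0) => //= _;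
    by [left | right].
rewrite finite_setU; split; first exact: asp_fin.
exact/finite_set_asp_preim/asp_fin.
Qed.

(* Products are read as composition of functions: [al * be] applies [be]
   first, unlike the library's product on [{perm T}]. *)
Definition asp_comp (al be : ASP) : ASP :=
  MkASP (bij_comp (asp_bij al) (asp_bij be)) (asp_comp_fin al be).

Lemma asp_inv_ex (al : ASP) :
  exists be : ASP, cancel al be /\ cancel be al.
Proof.
case: (asp_bij al) => g alK gK.
have gfin : finite_set (sign_changes g).
  apply: (sub_finite_set _ (finite_image al (asp_fin al))) => n /= ng.
  exists (g n); rewrite ?gK// /sign_changes /= gK addbC.
  exact: ng.
by exists (MkASP (Bijective gK alK) gfin).
Qed.

Definition asp_inv (al : ASP) : ASP := projT1 (cid (asp_inv_ex al)).

Lemma asp_invK (al : ASP) : cancel al (asp_inv al) /\ cancel (asp_inv al) al.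
Proof. exact: projT2 (cid (asp_inv_ex al)). Qed.

HB.instance Definition _ := gen_eqMixin ASP.
HB.instance Definition _ := gen_choiceMixin ASP.

Lemma asp_compA : associative asp_comp.
Proof. by move=> al be ga; apply: asp_ext. Qed.

Lemma asp_1comp : left_id asp_id asp_comp.
Proof. by move=> al; apply: asp_ext. Qed.

Lemma asp_comp1 : right_id asp_id asp_comp.
Proof. by move=> al; apply: asp_ext. Qed.

Lemma asp_Vcomp : left_inverse asp_id asp_inv asp_comp.
Proof. by move=> al; apply: asp_ext => n /=; case: (asp_invK al) => ->. Qed.

Lemma asp_compV : right_inverse asp_id asp_inv asp_comp.
Proof. by move=> al; apply: asp_ext => n /=; case: (asp_invK al) => _ ->. Qed.

HB.instance Definition _ :=
  isGroup.Build ASP asp_compA asp_1comp asp_comp1 asp_Vcomp asp_compV.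

Definition s_set (al : ASP) (a b : int) : set int :=
  [set n | b <= n /\ al n < a].

Lemma finite_itv_int (x y : int) : finite_set [set n | x <= n < y].
Proof.
apply: (@sub_finite_set _ _ ((fun k : nat => x + k%:Z) @` `I_(`|y - x|%N))).
  by move=> n /= xny; exists `|n - x|%N => /=; lia.
exact/finite_image/finite_II.
Qed.

Lemma finite_s_set (al : ASP) (a b : int) : finite_set (s_set al a b).
Proof.
apply: (@sub_finite_set _ _ ([set n : int | b <= n < 0]
  `|` (sign_changes al `|` al @^-1` [set n : int | 0 <= n < a]))) => [n|].
  rewrite /s_set /sign_changes /= => -[bn ana].
  have [n0|n0] := ltrP n 0; first by left; rewrite bn.
  have [an0|an0] := ltrP (al n) 0; first by right; left.
  by right; right; rewrite ana.
rewrite !finite_setU; split; first exact: finite_itv_int.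
split; first exact: asp_fin.
exact/finite_set_asp_preim/finite_itv_int.
Qed.

(* [fset_set A] is a junk value when [A] is infinite; [finite_s_set] rules
   this case out. *)
Definition s (al : ASP) (a b : int) : nat := #|` fset_set (s_set al a b)|.

Definition is_min (f : int -> nat) (m : nat) : Prop :=
  (exists l, f l = m) /\ (forall l, (m <= f l)%N).

Definition sigma_fun (n m : int) : int :=
  if m == n then n + 1 else if m == n + 1 then n else m.

Lemma sigma_funK (n : int) : involutive (sigma_fun n).
Proof.
move=> m; rewrite /sigma_fun /=.
case: (eqVneq m n) => [->|mn].
  by rewrite eqxx; case: eqP => // ; lia.
case: (eqVneq m (n + 1)) => [->|mn1]; first by rewrite eqxx.
by rewrite (negPf mn) (negPf mn1).
Qed.

Lemma sigma_fin (n : int) : finite_set (sign_changes (sigma_fun n)).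
Proof.
apply: (sub_finite_set _ (finite_set2 n (n + 1))) => m.
rewrite /sign_changes /sigma_fun /=.
case: (eqVneq m n) => [|mn]; first by left.
case: (eqVneq m (n + 1)) => [|mn1]; first by right.
by rewrite addbb.
Qed.

Definition sigma (n : int) : ASP :=
  MkASP (inv_bij (@sigma_funK n)) (@sigma_fin n).

Definition Sd_pred (d : nat) : {pred ASP} :=
  [pred al : ASP | `[< forall n : int, ~~ (1 <= n <= d%:Z) -> al n = n >]].

Lemma Sd_closed (d : nat) : group_closed (Sd_pred d).
Proof.
split=> [|al be]; first exact/asboolP.
move=> /asboolP fal /asboolP fbe; apply/asboolP => n nd.
rewrite -[RHS](fal n nd) /=; congr (al _).
by rewrite -[in LHS](fbe n nd); case: (asp_invK be) => ->.
Qed.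

Record Sd (d : nat) := MkSd { sd_val :> ASP; sd_valP : sd_val \in Sd_pred d }.

HB.instance Definition _ (d : nat) := [isSub for @sd_val d].
HB.instance Definition _ (d : nat) := [Choice of Sd d by <:].
HB.instance Definition _ (d : nat) :=
  SubChoice_isSubGroup.Build ASP (Sd_pred d) (Sd d) (Sd_closed d).

Lemma sigma_Sd (d : nat) (n : int) : 1 <= n < d%:Z -> sigma n \in Sd_pred d.
Proof.
move=> nd; apply/asboolP => m md; rewrite /= /sigma_fun /=.
by case: eqP => [?|_]; [lia | case: eqP => [?|//]; lia].
Qed.

Definition Sd_sigma (d : nat) (n : int) (nd : 1 <= n < d%:Z) : Sd d :=
  MkSd (sigma_Sd nd).

Definition is_Demazure_Sd (d : nat) (m : Sd d -> Sd d -> Sd d) : Prop :=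
  [/\ associative m,
      left_id 1%g m,
      right_id 1%g m
    & forall (al : Sd d) (n : int) (nd : 1 <= n < d%:Z),
        m al (Sd_sigma nd) =
        if al n < al (n + 1) then (al * Sd_sigma nd)%g else al].

(* Main.v *)
Require Import Defs.
From mathcomp Require Import all_boot all_order all_algebra.
From mathcomp Require Import finmap boolp classical_sets cardinality.
From mathcomp Require Import zify.
Import Order.TTheory GRing.Theory Num.Theory.
Local Open Scope ring_scope.

Set Implicit Arguments.
Unset Strict Implicit.
Unset Printing Implicit Defensive.

(** Write [s al] as a matrix indexed by pairs of integers.  The defining formula
for [star] is a matrix product in the min-plus semiring, so once it is known
that the product of [s al] and [s be] is again of the form [s ga] with [ga] in
[ASP], everything about associativity and uniqueness follows: [s] is injective
([s_inj]) and the min-plus product is associative.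

Which matrices are of the form [s ga]?  The mixed second difference of [s ga]
at [(a, b)] is 1 if [ga b = a] and 0 otherwise.  Hence [s ga] satisfies the
Monge inequality [s_monge] (second differences are nonnegative).  Moreover it
vanishes far in the directions [a -> -oo] and [b -> +oo], and equals the affine
function [a - b + c] far in the two opposite directions, where the constant [c]
depends on [ga] only.  Conversely ([asp_of_monge]), an integer matrix with these
properties is [s ga] for some [ga]: the difference between two consecutive
columns is a nondecreasing function of [a] going from 0 to 1, so it jumps
exactly once, and the place of the jump is [ga b]; the same argument on rows
gives the inverse of [ga], and the limit behaviour on the line [a = 0] bounds
the sign changes.

These properties pass to min-plus products ([star_exists]).  For the Monge
inequality, compare the minimizers [l1] and [l2] of two diagonally opposite
corners: if [l1 <= l2] they can be exchanged using the inequality for [al], and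
otherwise using the inequality for [be].  The affine regime is handled by a
duality: [s al a b - (a - b + c)] counts the [n < b] with [al n >= a], and this
is the matrix [s] of the permutation obtained from [al] by conjugation with
[n |-> -1 - n] ([s_mirror]).

For the rule on simple transpositions, [s (sigma n)] is the matrix of the
identity, [max (a - b) 0], with 1 added at the single place [(n + 1, n + 1)].
As [s al a] is nonincreasing with steps at most 1, the product with the matrix
of the identity changes nothing, and only the column [b = n + 1] needs a
computation.

Finally, each element of [S_d] other than the identity has a descent [n], and is
then [y * sigma n] for a smaller [y] with [y n < y (n + 1)].  The induction
principle [Sd_ind] obtained in this way shows that [star] preserves [S_d] and
that a Demazure product on [S_d] is determined by its rule. *)

(** * Functions on the integers *)

Lemma finite_int_bound (A : set int) :
  finite_set A -> exists B : int, forall n : int, A n -> - B <= n <= B.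
Proof.
move=> fA; exists (\sum_(m <- finmap.enum_fset (fset_set A)) `|m|%N)%:Z => n An.
have nA : n \in finmap.enum_fset (fset_set A) by rewrite in_fset_set// inE.
by rewrite (big_rem _ nA) /=; lia.
Qed.

Lemma int_step_const (T : Type) (f : int -> T) :
  (forall x : int, f (x + 1) = f x) -> forall x y : int, f x = f y.
Proof.
move=> fS; have key (x : int) (k : nat) : f (x + k%:Z) = f x.
  elim: k => [|k IHk]; first by rewrite addr0.
  by rewrite -[in RHS]IHk -[in RHS]fS; congr f; lia.
move=> x y; have [xy|yx] := lerP x y.
  by rewrite -(key x `|y - x|%N); congr f; lia.
by rewrite -(key y `|x - y|%N); congr f; lia.
Qed.

Lemma int_step_le (f : int -> int) :
  (forall x : int, f x <= f (x + 1)) -> forall x y : int, x <= y -> f x <= f y.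
Proof.
move=> fS; have key (x : int) (k : nat) : f x <= f (x + k%:Z).
  elim: k => [|k IHk]; first by rewrite addr0.
  by apply: (le_trans IHk); apply: (le_trans (fS _)); rewrite le_eqVlt;
    apply/orP; left; apply/eqP; congr f; lia.
by move=> x y xy; have := key x `|y - x|%N; have -> : x + `|y - x|%N%:Z = y by lia.
Qed.

(** The steps of a nondecreasing integer function going from 0 to 1 reduce to a
single unit jump; this is how a permutation is read off from a matrix. *)
Lemma int_step_indicator (f : int -> int) :
    (forall x : int, f x <= f (x + 1)) ->
    (exists A : int, forall x : int, x <= A -> f x = 0) ->
    (exists A : int, forall x : int, A <= x -> f x = 1) ->
  exists y : int, forall x : int, f x = (y < x)%R%:Z.
Proof.
move=> fS [A fA] [A' fA'].
have f_le := int_step_le fS.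
have exk : exists k : nat, f (A + k%:Z) == 1.
  by exists `|A' - A|%N; rewrite fA'//; lia.
case: (ex_minnP exk) => k /eqP fk kmin.
have k_gt0 : (0 < k)%N.
  by case: k fk {kmin} => // ; rewrite addr0 fA.
have fk1 : f (A + k%:Z - 1) = 0.
  have neq1 : f (A + k%:Z - 1) != 1.
    apply/negP => f1; have : (k <= k.-1)%N.
      by apply: kmin; have -> : A + k.-1%:Z = A + k%:Z - 1 by lia.
    by lia.
  have := f_le A (A + k%:Z - 1); rewrite (fA A)//.
  by have := f_le (A + k%:Z - 1) (A + k%:Z); rewrite fk; lia.
(* [A + k] is the first place where [f] is 1, so the jump is just before it. *)
exists (A + k%:Z - 1) => x; case: ltrP => [lt_x|le_x].
  have := f_le (A + k%:Z) x; rewrite fk.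
  by have := f_le x (Num.max x A'); rewrite (fA' (Num.max x A')); lia.
have := f_le x (A + k%:Z - 1); rewrite fk1.
by have := f_le (Num.min x A) x; rewrite (fA (Num.min x A)); lia.
Qed.

(** * The matrix of a permutation *)

Lemma s_right_step (al : ASP) (a b : int) :
  s al a b = ((al b < a)%R + s al a (b + 1))%N.
Proof.
rewrite /s; have [ab|ab] := ltrP (al b) a.
  have -> : s_set al a b = (b |` s_set al a (b + 1))%classic.
    apply/seteqP; split => n /=; rewrite /s_set /=.
      case=> bn an; case: (eqVneq n b) => [|nb]; first by left.
      by right; split=> //; lia.
    by case=> [->|[bn an]]; split=> //; lia.
  rewrite fset_setU1; last exact: finite_s_set.
  rewrite finmap.cardfsU1 in_fset_set; last exact: finite_s_set.
  by rewrite memNset// /s_set /=; lia.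
have -> : s_set al a b = s_set al a (b + 1) => //.
apply/seteqP; split => n; rewrite /s_set /= => -[bn an]; split=> //; last by lia.
by case: (eqVneq n b) => [nb|]; [rewrite nb in an|]; lia.
Qed.

(** The row step at [al n] rather than at an arbitrary integer, which avoids the
inverse of [al]: any integer is some [al n]. *)
Lemma s_left_step (al : ASP) (n b : int) :
  s al (al n + 1) b = ((b <= n)%R + s al (al n) b)%N.
Proof.
rewrite /s; have [bn|nb] := lerP b n.
  have -> : s_set al (al n + 1) b = (n |` s_set al (al n) b)%classic.
    apply/seteqP; split => m /=; rewrite /s_set /=.
      case=> bm am; case: (eqVneq m n) => [|mn]; first by left.
      have : al m != al n by apply: contra_neq mn => /asp_inj.
      by right; split=> //; lia.
    by case=> [->|[bm am]]; split=> //; lia.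
  rewrite fset_setU1; last exact: finite_s_set.
  rewrite finmap.cardfsU1 in_fset_set; last exact: finite_s_set.
  by rewrite memNset// /s_set /=; lia.
have -> : s_set al (al n + 1) b = s_set al (al n) b => //.
apply/seteqP; split => m; rewrite /s_set /= => -[bm am]; split=> //; last by lia.
have : al m != al n by apply/eqP => /asp_inj; lia.
lia.
Qed.

Lemma s_eq0_right (al : ASP) (a : int) :
  exists B : int, forall b : int, B <= b -> s al a b = 0%N.
Proof.
have [B hB] := finite_int_bound (finite_s_set al a 0).
exists (`|B|%N%:Z + 1) => b Bb; rewrite /s.
have -> : s_set al a b = set0; last by rewrite fset_set0 finmap.cardfs0.
apply/seteqP; split => n //; rewrite /s_set /= => -[bn an].
have : s_set al a 0 n by split => //; lia.
by move=> /hB; lia.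
Qed.

Lemma s_eq0_left (al : ASP) (b : int) :
  exists A : int, forall a : int, a <= A -> s al a b = 0%N.
Proof.
have [B hB] := finite_int_bound (finite_image al (finite_s_set al 0 b)).
exists (- `|B|%N%:Z - 1) => a aB; rewrite /s.
have -> : s_set al a b = set0; last by rewrite fset_set0 finmap.cardfs0.
apply/seteqP; split => n //; rewrite /s_set /= => -[bn an].
have : (al @` s_set al 0 b)%classic (al n) by exists n => //; split => //; lia.
by move=> /hB; lia.
Qed.

(** The column steps determine [s al a] up to a constant, and the vanishing for
large [b] fixes the constant.  All explicit values of [s] come from here. *)
Lemma s_unique (al : ASP) (a : int) (g : int -> int) :
    (forall b : int, g b = (al b < a)%R%:Z + g (b + 1)) ->
    (exists B : int, forall b : int, B <= b -> g b = 0) ->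
  forall b : int, (s al a b)%:Z = g b.
Proof.
move=> gS [B gB]; have [B' sB'] := s_eq0_right al a.
have diffS (b : int) : (s al a (b + 1))%:Z - g (b + 1) = (s al a b)%:Z - g b.
  by rewrite (s_right_step al a b) (gS b); lia.
move=> b; have := int_step_const diffS b (Num.max B B').
by rewrite (gB (Num.max B B')) ?(sB' (Num.max B B')); lia.
Qed.

Lemma s_inj (al be : ASP) : (forall a b : int, s al a b = s be a b) -> al = be.
Proof.
move=> sE; apply: asp_ext => n.
have lt_iff (a : int) : (al n < a) = (be n < a).
  have := s_right_step al a n; have := s_right_step be a n.
  by rewrite !sE; case: ltrP; case: ltrP; lia.
by have := lt_iff (al n + 1); have := lt_iff (be n + 1); lia.
Qed.

(** Since [s al a] is nonincreasing with steps at most 1, multiplying by the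
matrix [max (l - b) 0] of the identity cannot lower a value. *)
Lemma s_right_lipschitz (al : ASP) (a b l : int) :
  (s al a b)%:Z <= (s al a l)%:Z + Num.max (l - b) 0.
Proof.
have mono1 (x : int) : - (s al a x)%:Z <= - (s al a (x + 1))%:Z.
  by rewrite (s_right_step al a x); lia.
have mono2 (x : int) : (s al a x)%:Z + x <= (s al a (x + 1))%:Z + (x + 1).
  by rewrite (s_right_step al a x); lia.
have [bl|lb] := lerP b l.
  by have := int_step_le mono2 bl; lia.
by have := int_step_le mono1 (ltW lb); lia.
Qed.

Lemma s_left_lipschitz (al : ASP) (a b l : int) :
  (s al a b)%:Z <= (s al l b)%:Z + Num.max (a - l) 0.
Proof.
have recl (x : int) : exists c : bool, s al (x + 1) b = (c + s al x b)%N.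
  have [_ al_inv] := asp_invK al.
  by exists (b <= asp_inv al x)%R; rewrite -{1 3}(al_inv x) s_left_step.
have mono1 (x : int) : (s al x b)%:Z <= (s al (x + 1) b)%:Z.
  by case: (recl x) => c ->; lia.
have mono2 (x : int) : x - (s al x b)%:Z <= (x + 1) - (s al (x + 1) b)%:Z.
  by case: (recl x) => c ->; lia.
have [le_al|la] := lerP a l.
  by have := int_step_le mono1 le_al; lia.
by have := int_step_le mono2 (ltW la); lia.
Qed.

(** The difference of the two rows counts the [n >= b] with [a <= al n < a'],
which can only decrease when [b] grows. *)
Lemma s_monge (al : ASP) (a a' b b' : int) : a <= a' -> b <= b' ->
  (s al a b + s al a' b' <= s al a' b + s al a b')%N.
Proof.
move=> aa' bb'.
have mono (x : int) : (s al a x)%:Z - (s al a' x)%:Z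
    <= (s al a (x + 1))%:Z - (s al a' (x + 1))%:Z.
  by rewrite (s_right_step al a x) (s_right_step al a' x); case: ltrP; case: ltrP; lia.
by have := int_step_le mono bb'; lia.
Qed.

(** * Duality *)

Lemma mirror_bij (al : ASP) : bijective (fun n => -1 - al (-1 - n)).
Proof.
have [alK Kal] := asp_invK al.
by exists (fun n => -1 - asp_inv al (-1 - n)) => n; rewrite !subKr ?alK ?Kal subKr.
Qed.

Lemma mirror_fin (al : ASP) :
  finite_set (sign_changes (fun n => -1 - al (-1 - n))).
Proof.
apply: (sub_finite_set _ (finite_image (fun n => -1 - n) (asp_fin al))) => n.
rewrite /sign_changes /= => nP; exists (-1 - n); last by rewrite subKr.
have -> : (-1 - n < 0) = ~~ (n < 0) by lia.
have -> : (al (-1 - n) < 0) = ~~ (-1 - al (-1 - n) < 0) by lia.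
by rewrite addNb addbN negbK.
Qed.

(** Conjugation by the reflection [n |-> -1 - n], which exchanges the negative
and the nonnegative integers. *)
Definition mirror (al : ASP) : ASP := MkASP (mirror_bij al) (mirror_fin al).

(** The term [s (mirror al) (- a) (- b)] is the number of [n < b] with
[al n >= a].  Moving [a] or [b] by one changes its difference with [s al a b] by
exactly one, hence the affine term. *)
Lemma s_mirror (al : ASP) : exists c : int, forall a b : int,
  (s al a b)%:Z = (s (mirror al) (- a) (- b))%:Z + (a - b + c).
Proof.
pose u (a b : int) := (s al a b)%:Z - (s (mirror al) (- a) (- b))%:Z - (a - b).
have uSr (a b : int) : u a (b + 1) = u a b.
  rewrite /u (s_right_step al a b) (s_right_step (mirror al) (- a) (- (b + 1))) /=.
  have -> : -1 - - (b + 1) = b by lia.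
  have -> : - (b + 1) + 1 = - b by lia.
  by case: ltrP; case: ltrP; lia.
have uSl (b a : int) : u (a + 1) b = u a b.
  have [_ Kal] := asp_invK al; rewrite -(Kal a); set n := asp_inv al a.
  rewrite /u (s_left_step al n b).
  have := s_left_step (mirror al) (-1 - n) (- b) => /=.
  rewrite subKr.
  have -> : -1 - al n + 1 = - al n by lia.
  have -> : -1 - al n = - (al n + 1) by lia.
  by move=> ->; case: lerP; case: lerP; lia.
exists (u 0 0) => a b.
have : u a b = u 0 0.
  by rewrite (int_step_const (uSr a) b 0) (int_step_const (uSl 0) a 0).
by move=> <-; rewrite /u; lia.
Qed.

(** * Permutations from Monge matrices *)

Section Reconstruction.
Variables (f : int -> int -> int) (c : int).
Hypothesis f_monge :
  forall a b : int, f a b + f (a + 1) (b + 1) <= f (a + 1) b + f a (b + 1).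
Hypothesis f_right : forall a : int, exists B : int, forall b : int, B <= b -> f a b = 0.
Hypothesis f_left : forall b : int, exists A : int, forall a : int, a <= A -> f a b = 0.
Hypothesis f_leftr :
  forall a : int, exists B : int, forall b : int, b <= B -> f a b = a - b + c.
Hypothesis f_rightl :
  forall b : int, exists A : int, forall a : int, A <= a -> f a b = a - b + c.

Let row_jump (b : int) : exists y : int, forall a : int, f a b - f a (b + 1) = (y < a)%R%:Z.
Proof.
apply: int_step_indicator.
- by move=> a; have := f_monge a b; lia.
- have [[A hA] [A' hA']] := (f_left b, f_left (b + 1)).
  by exists (Num.min A A') => a aA; rewrite hA ?hA'; lia.
have [[A hA] [A' hA']] := (f_rightl b, f_rightl (b + 1)).
by exists (Num.max A A') => a aA; rewrite hA ?hA'; lia.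
Qed.

Let col_jump (a : int) : exists y : int, forall b : int, f (a + 1) b - f a b = (b <= y)%R%:Z.
Proof.
suff [y hy] : exists y : int, forall b : int, 1 - (f (a + 1) b - f a b) = (y < b)%R%:Z.
  by exists y => b; have := hy b; case: lerP; case: ltrP; lia.
apply: int_step_indicator.
- by move=> b; have := f_monge a b; lia.
- have [[B hB] [B' hB']] := (f_leftr a, f_leftr (a + 1)).
  by exists (Num.min B B') => b bB; rewrite hB ?hB'; lia.
have [[B hB] [B' hB']] := (f_right a, f_right (a + 1)).
by exists (Num.max B B') => b bB; rewrite hB ?hB'; lia.
Qed.

(** The column jumps define [g], the row jumps define [h], and both say where
the mixed second difference of [f] is 1, so that they are mutually inverse. *)
Lemma asp_of_monge : exists ga : ASP, forall a b : int, (s ga a b)%:Z = f a b.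
Proof.
have [g gP] := choice row_jump; have [h hP] := choice col_jump.
(* Both sides say that the mixed second difference of [f] at [(a, b)] is 1. *)
have ghE (a b : int) : (g b == a) = (h a == b).
  have := gP b a; have := gP b (a + 1); have := hP a b; have := hP a (b + 1).
  by do 2![case: lerP]; do 2![case: ltrP]; do 2![case: eqVneq]; lia.
have gK : cancel g h by move=> n; apply/eqP; rewrite -ghE.
have hK : cancel h g by move=> n; apply/eqP; rewrite ghE.
(* On the line [a = 0], [f] is eventually 0 on the right, where [g] is then
   nonnegative, and eventually affine on the left, where [g] is negative. *)
have gfin : finite_set (sign_changes g).
  have [[B hB] [B' hB']] := (f_right 0, f_leftr 0).
  apply: (sub_finite_set _ (finite_itv_int (Num.min B' 0 - 1) (Num.max B 0))) => n.
  rewrite /sign_changes /= => sn; apply/andP; split.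
    rewrite leNgt; apply/negP => nB.
    by have := gP n 0; rewrite (hB' n) ?(hB' (n + 1)); move: sn; lia.
  rewrite ltNge; apply/negP => nB.
  by have := gP n 0; rewrite (hB n) ?(hB (n + 1)); move: sn; lia.
exists (MkASP (Bijective gK hK) gfin) => a b.
apply: s_unique => [{}b|]; last exact: f_right.
by rewrite /= -(gP b a); lia.
Qed.

End Reconstruction.

(** * The min-plus product of two permutations *)

Lemma is_min_exists (f : int -> nat) : exists m, is_min f m.
Proof.
have exf : exists k, `[< exists l, f l = k >].
  by exists (f 0); apply/asboolP; exists 0.
case: (ex_minnP exf) => m /asboolP fm m_min; exists m; split=> // l.
by apply: m_min; apply/asboolP; exists l.
Qed.

(** The min-plus product of two matrices [s] satisfies the hypotheses of
[asp_of_monge]; its affine term is the sum of those of the factors, so that it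
is enough to find, far enough, one index [l] at which both dual counts are 0. *)
Lemma star_exists (al be : ASP) : exists ga : ASP, forall a b : int,
  is_min (fun l : int => (s al a l + s be l b)%N) (s ga a b).
Proof.
have /choice[m mP] : forall ab : int * int, exists m,
    is_min (fun l : int => (s al ab.1 l + s be l ab.2)%N) m.
  by move=> ab; apply: is_min_exists.
have m_le (a b l : int) : (m (a, b) <= s al a l + s be l b)%N.
  by have [_ /(_ l)] := mP (a, b).
have [c sc] := s_mirror al; have [c' sc'] := s_mirror be.
have m_ge (a b : int) : a - b + (c + c') <= (m (a, b))%:Z.
  have [[l /= <-] _] := mP (a, b).
  by have := sc a l; have := sc' l b; lia.
suff [ga gaE] : exists ga : ASP, forall a b : int, (s ga a b)%:Z = (m (a, b))%:Z.
  by exists ga => a b; have /= := mP (a, b); have [->] := gaE a b.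
apply: (@asp_of_monge _ (c + c')) => [a b|a|b|a|b].
(* Monge inequality: exchange the minimizers of the two right-hand terms, in
   the matrix of [al] or in that of [be] according to their order. *)
- have [[l1 /= <-] _] := mP (a + 1, b); have [[l2 /= <-] _] := mP (a, b + 1).
  have [l12|l21] := lerP l1 l2.
    have := m_le a b l1; have := m_le (a + 1) (b + 1) l2.
    by have := @s_monge al a (a + 1) l1 l2; lia.
  have := m_le a b l2; have := m_le (a + 1) (b + 1) l1.
  by have := @s_monge be l2 l1 b (b + 1); lia.
- have [l hl] := s_eq0_right al a; have [B hB] := s_eq0_right be l.
  by exists B => b bB; have := m_le a b l; rewrite hl ?hB; lia.
- have [l hl] := s_eq0_left be b; have [A hA] := s_eq0_left al l.
  by exists A => a aA; have := m_le a b l; rewrite hl ?hA; lia.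
- have [l hl] := s_eq0_right (mirror al) (- a).
  have [B hB] := s_eq0_right (mirror be) l.
  exists (- B) => b bB; have := m_le a b (- l); have := m_ge a b.
  have := sc a (- l); have := sc' (- l) b.
  by rewrite opprK hl ?hB; lia.
have [l hl] := s_eq0_left (mirror be) (- b).
have [A hA] := s_eq0_left (mirror al) l.
exists (- A) => a aA; have := m_le a b (- l); have := m_ge a b.
have := sc a (- l); have := sc' (- l) b.
by rewrite opprK hl ?hA; lia.
Qed.

Definition star (al be : ASP) : ASP := projT1 (cid (star_exists al be)).

Lemma starP (al be : ASP) (a b : int) :
  is_min (fun l : int => (s al a l + s be l b)%N) (s (star al be) a b).
Proof. exact: projT2 (cid (star_exists al be)) a b. Qed.

Lemma is_min_unique (f : int -> nat) (m m' : nat) :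
  is_min f m -> is_min f m' -> m = m'.
Proof.
case=> -[l <-] fl [[l' <-] fl'].
by apply/eqP; rewrite eqn_leq fl fl'.
Qed.

Lemma star_unique (al be ga : ASP) :
    (forall a b : int, is_min (fun l : int => (s al a l + s be l b)%N) (s ga a b)) ->
  ga = star al be.
Proof. by move=> gaP; apply: s_inj => a b; apply: is_min_unique (starP _ _ _ _). Qed.

Lemma star_assoc : associative star.
Proof.
move=> al be ga; apply: s_inj => a b; apply/eqP; rewrite eqn_leq.
apply/andP; split.
  have [[k <-] _] := starP (star al be) ga a b.
  have [[l <-] _] := starP al be a k.
  have [_ /(_ l)] := starP al (star be ga) a b.
  by have [_ /(_ k)] := starP be ga l b; lia.
have [[l <-] _] := starP al (star be ga) a b.
have [[k <-] _] := starP be ga l b.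
have [_ /(_ k)] := starP (star al be) ga a b.
by have [_ /(_ l)] := starP al be a k; lia.
Qed.

(** * Products with the identity and with simple transpositions *)

Lemma s_id (a b : int) : (s 1%g a b)%:Z = Num.max (a - b) 0.
Proof.
apply: (@s_unique _ _ (fun b => Num.max (a - b) 0)) => [{}b /=|]; first by lia.
by exists a => {}b ab; lia.
Qed.

Lemma star1 (al : ASP) : star al 1%g = al.
Proof.
symmetry; apply: star_unique => a b; split.
  by exists b; have := s_id b b; lia.
by move=> l; have := s_id l b; have := s_right_lipschitz al a b l; lia.
Qed.

Lemma star1_left (al : ASP) : star 1%g al = al.
Proof.
symmetry; apply: star_unique => a b; split.
  by exists a; have := s_id a a; lia.
by move=> l; have := s_id a l; have := s_left_lipschitz al a b l; lia.
Qed.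

Lemma s_sigma (n a b : int) : (s (sigma n) a b)%:Z =
  Num.max (a - b) 0 + ((a == n + 1) && (b == n + 1))%:Z.
Proof.
apply: (@s_unique _ _ (fun b => Num.max (a - b) 0 +
  ((a == n + 1) && (b == n + 1))%:Z)) => [{}b /=|]; last first.
  by exists (Num.max a (n + 2)) => {}b ab; lia.
rewrite /sigma_fun; case: (eqVneq b n) => [->|bn]; first by lia.
by case: (eqVneq b (n + 1)) => [->|bn1]; lia.
Qed.

(** Only the count over [m >= n + 1] sees whether the values at [n] and [n + 1]
have been exchanged: it then loses [al (n + 1)] and gains [al n]. *)
Lemma s_mul_sigma (al : ASP) (n a b : int) : al n < al (n + 1) ->
  s (al * sigma n)%g a b =
  (s al a b + ((b == n + 1) && (al n < a <= al (n + 1)))%R)%N.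
Proof.
move=> lt_al; suff : (s (al * sigma n)%g a b)%:Z =
    (s al a b + ((b == n + 1) && (al n < a <= al (n + 1)))%R)%N%:Z by lia.
apply: (@s_unique _ _ (fun b => (s al a b +
  ((b == n + 1) && (al n < a <= al (n + 1)))%R)%N%:Z)) => [{}b|]; last first.
  have [B hB] := s_eq0_right al a.
  by exists (Num.max B (n + 2)) => {}b ab; rewrite hB; lia.
rewrite (s_right_step al a b) /= /sigma_fun; case: (eqVneq b n) => [->|bn]; first by lia.
by case: (eqVneq b (n + 1)) => [->|bn1]; lia.
Qed.

(** Outside the column [b = n + 1] the matrix of [sigma n] is that of the
identity.  In that column the candidates are [l = n], [n + 1] and [n + 2], whose
values exceed [s al a (n + 1)] by [al n < a], by 1 and by [a <= al (n + 1)]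
respectively; the least excess is 1 exactly if [al n < a <= al (n + 1)]. *)
Lemma star_sigma (al : ASP) (n : int) :
  star al (sigma n) = if al n < al (n + 1) then (al * sigma n)%g else al.
Proof.
symmetry; apply: star_unique => a b.
set e : nat := (b == n + 1) && (al n < a <= al (n + 1)).
have -> : s (if al n < al (n + 1) then (al * sigma n)%g else al) a b = (s al a b + e)%N.
  case: ifPn => [/s_mul_sigma-> //|]; rewrite /e; lia.
have recn := s_right_step al a n; have recn1 := s_right_step al a (n + 1).
have n2E : n + 1 + 1 = n + 2 by lia.
rewrite n2E in recn1.
split=> [|l]; last first.
  have := s_sigma n l b; have := s_right_lipschitz al a b l; rewrite /e.
  case: (eqVneq b (n + 1)) => [->|bn] /=; last by lia.
  by have := s_right_lipschitz al a n l; have := s_right_lipschitz al a (n + 2) l; lia.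
case: (eqVneq b (n + 1)) => [bE|bn]; last first.
  by exists b; have := s_sigma n b b; rewrite /e; lia.
subst b; rewrite /e.
have [an|na] := ltrP (al n) a; last first.
  by exists n; have := s_sigma n n (n + 1); lia.
have [an1|na1] := ltrP (al (n + 1)) a.
  by exists (n + 2); have := s_sigma n (n + 2) (n + 1); lia.
by exists (n + 1); have := s_sigma n (n + 1) (n + 1); lia.
Qed.

(** * Restriction to finite symmetric groups *)

Lemma Sd_fix (d : nat) (y : Sd d) (n : int) : ~~ (1 <= n <= d%:Z) -> y n = n.
Proof. by have /asboolP := sd_valP y; apply. Qed.

Lemma Sd_range (d : nat) (y : Sd d) (n : int) :
  1 <= n <= d%:Z -> 1 <= y n <= d%:Z.
Proof.
move=> nd; apply/negPn/negP => ynd.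
by have /asp_inj yn := Sd_fix y ynd; rewrite yn nd in ynd.
Qed.

(** The function [y m - m] is nondecreasing on all integers and vanishes outside
the interval from 1 to [d], so it is 0. *)
Lemma Sd_increasing_id (d : nat) (y : Sd d) :
  (forall n : int, 1 <= n < d%:Z -> y n < y (n + 1)) -> y = 1%g.
Proof.
move=> y_incr; apply: val_inj; apply: asp_ext => n /=.
have mono (m : int) : y m - m <= y (m + 1) - (m + 1).
  have [md|md] := boolP (1 <= m < d%:Z); first by have := y_incr _ md; lia.
  have [m1d|m1d] := boolP (1 <= m <= d%:Z).
    by have := Sd_range y m1d; rewrite (@Sd_fix _ y (m + 1)); lia.
  rewrite (Sd_fix y m1d); have [m2d|m2d] := boolP (1 <= m + 1 <= d%:Z).
    by have := Sd_range y m2d; lia.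
  by rewrite (Sd_fix y m2d); lia.
have := int_step_le mono (_ : Num.min n 0 <= n).
have := int_step_le mono (_ : n <= Num.max n (d%:Z + 1)).
rewrite (@Sd_fix _ y (Num.min n 0)) ?(@Sd_fix _ y (Num.max n (d%:Z + 1))); lia.
Qed.

(** A substitute for the Coxeter length: by [s_mul_sigma] it increases along
length-increasing multiplications by simple transpositions. *)
Definition s_sum (d : nat) (y : ASP) : nat :=
  \sum_(p : 'I_d.+1 * 'I_d.+1) s y (p.1 : nat)%:Z (p.2 : nat)%:Z.

Lemma s_sum_lt (d : nat) (y : Sd d) (n : int) (nd : 1 <= n < d%:Z) :
  y n < y (n + 1) -> (s_sum d y < s_sum d (y * Sd_sigma nd)%g)%N.
Proof.
move=> lt_y.
have n1d : (`|(n + 1)%R| < d.+1)%N by lia.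
have yn1 : 1 <= y (n + 1) <= d%:Z by apply: Sd_range; lia.
have yn1d : (`|y (n + 1)%R| < d.+1)%N by lia.
(* By [s_mul_sigma] the strict increase occurs at [(y (n + 1), n + 1)]. *)
pose p := (Ordinal yn1d, Ordinal n1d).
rewrite /s_sum (bigD1 p) //= [ltnRHS](bigD1 p) //= -addSn.
apply: leq_add; last by apply: leq_sum => q _; rewrite s_mul_sigma; lia.
by rewrite s_mul_sigma; lia.
Qed.

(** Induction along reduced words: exchanging the values at a descent lowers
[s_sum], and only the identity has no descent. *)
Lemma Sd_ind (d : nat) (P : Sd d -> Prop) :
    P 1%g ->
    (forall (y : Sd d) (n : int) (nd : 1 <= n < d%:Z),
       y n < y (n + 1) -> P y -> P (y * Sd_sigma nd)%g) ->
  forall y, P y.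
Proof.
move=> P1 PM y; have [k] := ubnP (s_sum d y); elim: k y => // k IHk y yk.
have [[n [nd desc]]|no_desc] :=
    pselect (exists n : int, 1 <= n < d%:Z /\ y (n + 1) < y n); last first.
  rewrite (@Sd_increasing_id _ y)// => n nd; rewrite lt_neqAle; apply/andP; split.
    by apply/eqP => /asp_inj; lia.
  by rewrite leNgt; apply/negP => desc; apply: no_desc; exists n.
have yE : y = (y * Sd_sigma nd * Sd_sigma nd)%g.
  by apply: val_inj; apply: asp_ext => m /=; rewrite sigma_funK.
have incr : (y * Sd_sigma nd)%g n < (y * Sd_sigma nd)%g (n + 1).
  rewrite /= /sigma_fun !eqxx.
  by case: eqP => //; lia.
rewrite yE; apply: PM => //; apply: IHk.
have := s_sum_lt nd incr; rewrite -yE => lt_yk.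
by apply: leq_trans lt_yk _.
Qed.

(** The second factor is built by length-increasing multiplications, which are
products for [star]; by associativity it acts on [x] by one simple transposition
at a time. *)
Lemma star_Sd (d : nat) (x y : Sd d) : star x y \in Sd_pred d.
Proof.
elim/Sd_ind: y => [|y n nd lt_y xyd]; first by rewrite star1 sd_valP.
have -> : sd_val (y * Sd_sigma nd)%g = star y (sigma n).
  by rewrite star_sigma lt_y.
rewrite star_assoc star_sigma; case: ifP => // _.
exact: (sd_valP (MkSd xyd * Sd_sigma nd)%g).
Qed.

Definition Sd_star (d : nat) (x y : Sd d) : Sd d := MkSd (star_Sd x y).

Lemma Sd_star_Demazure (d : nat) : is_Demazure_Sd (@Sd_star d).
Proof.
split=> [x y z|x|x|x n nd]; apply: val_inj => /=.
- exact: star_assoc.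
- exact: star1_left.
- exact: star1.
by rewrite star_sigma; case: ifP.
Qed.

(** Along a reduced word of [y], associativity reduces [m x y] to successive
products with simple transpositions, which the rule prescribes. *)
Lemma is_Demazure_Sd_unique (d : nat) (m m' : Sd d -> Sd d -> Sd d) :
  is_Demazure_Sd m -> is_Demazure_Sd m' -> m = m'.
Proof.
case=> mA _ m1 mS [m'A _ m'1 m'S]; apply/funext => x; apply/funext => y.
elim/Sd_ind: y => [|y n nd lt_y IHy]; first by rewrite m1 m'1.
have mE : (y * Sd_sigma nd)%g = m y (Sd_sigma nd) by rewrite mS lt_y.
have m'E : (y * Sd_sigma nd)%g = m' y (Sd_sigma nd) by rewrite m'S lt_y.
by rewrite {1}mE m'E mA m'A IHy mS m'S.
Qed.

Theorem theoremA :
  exists star : ASP -> ASP -> ASP,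
    [/\ associative star,
        forall (al be : ASP) (a b : int),
          is_min (fun l : int => (s al a l + s be l b)%N) (s (star al be) a b),
        forall al be ga : ASP,
          (forall a b : int,
             is_min (fun l : int => (s al a l + s be l b)%N) (s ga a b)) ->
          ga = star al be,
        forall (al : ASP) (n : int),
          star al (sigma n) = if al n < al (n + 1) then (al * sigma n)%g else al
      & forall d : nat,
          exists2 m : Sd d -> Sd d -> Sd d,
            unique (@is_Demazure_Sd d) m
            & forall x y : Sd d, sd_val (m x y) = star (sd_val x) (sd_val y)].
Proof.
exists star; split.
- exact: star_assoc.
- exact: starP.
- exact: star_unique.
- exact: star_sigma.
move=> d; exists (@Sd_star d) => //; split; first exact: Sd_star_Demazure.
by move=> m; apply: is_Demazure_Sd_unique; apply: Sd_star_Demazure.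
Qed.
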